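(* Let $G$ be a finite graph (multiple edges allowed) with vertex set $V$ and edge set $E$, each edge $e$ joining two distinct vertices $v_1(e),v_2(e)$, and every vertex $v$ having degree $d_v>0$. For each $v\in V$ let $C(v)$ be a finite nonempty set of nonnegative integers, let $(C)$ be the set of subsets $M\subset E$ with $d_M(v)\in C(v)$ for all $v$ (where $d_M(v)$ is the number of edges of $M$ incident to $v$), assume $(C)\ne\emptyset$, and let $P_{(C)}(z)=\sum_{M\in(C)}z^{|M|}$. For $v\in V$ let $p_v(z)=\sum_{k\in C(v)}\binom{d_v}{k}z^k$. Suppose that for each $v\in V$ there is an angle $\phi_v\in[0,\pi/2]$ such that every nonzero root $\zeta$ of $p_v$ satisfies $|\arg(\zeta)|\in[\pi-\phi_v,\pi]$. Let $$S=\{\theta\in[-\pi,\pi]:\ \exists(\theta_v)_{v\in V}\text{ with }|\theta_v|\le\pi/2-\phi_v\text{ for all }v\text{ and }\theta_{v_1(e)}+\theta_{v_2(e)}=\theta\text{ for all }e\in E\}.$$ Then every nonzero root $\xi$ of $P_{(C)}$ satisfies $|\arg(\xi)|\in[\max S,\pi]$.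
   Context: $\arg$ takes values in $(-\pi,\pi]$. $S$ is nonempty (it contains $0$) and closed. *)

(* Defs.v *)
From HB Require Import structures.
From mathcomp Require Import all_boot all_order all_algebra finmap complex.
From mathcomp Require Import all_classical all_reals all_analysis.
From mathcomp Require Import ring lra.

Set Implicit Arguments.
Unset Strict Implicit.
Unset Printing Implicit Defensive.

Import Order.TTheory GRing.Theory Num.Theory.
Import numFieldNormedType.Exports.

Local Open Scope classical_set_scope.
Local Open Scope ring_scope.

Section Argument.
Variable R : realType.

(* The principal argument, with values in (-pi, pi] (see cargP); the value at
   0 is junk. *)
Definition carg (z : R[i]) : R :=
  let t := acos (complex.Re z / Normc.normc z) in
  if 0 <= complex.Im z then t else - t.

Lemma cargP (z : R[i]) : z != 0 ->
  - pi < carg z <= pi /\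
  z = Complex (Normc.normc z * cos (carg z)) (Normc.normc z * sin (carg z)).
Proof.
move=> z0.
have n0 : Normc.normc z != 0 by apply: contra z0 => /eqP/Normc.eq0_normc ->.
have ngt : 0 < Normc.normc z.
  by rewrite lt_neqAle eq_sym n0; case: {n0 z0} z => a b; exact: sqrtr_ge0.
have n2 : Normc.normc z ^+ 2 = complex.Re z ^+ 2 + complex.Im z ^+ 2.
  by case: {n0 ngt z0} z => a b /=; rewrite sqr_sqrtr// addr_ge0// sqr_ge0.
rewrite /carg; move: n0 ngt n2; case: z z0 => a b _.
rewrite /complex.Re /complex.Im; set n := Normc.normc _ => n0 ngt n2.
set q := a / n.
have qb : 1 - q ^+ 2 = (b / n) ^+ 2.
  by rewrite /q !expr_div_n; move: n2 => /eqP; rewrite -subr_eq => /eqP <-; field.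
have q2 : q ^+ 2 <= 1 by rewrite -subr_ge0 qb sqr_ge0.
have q1 : -1 <= q <= 1 by rewrite -ler_norml -(@expr_le1 _ 2)// real_normK ?num_real.
have cq : cos (acos q) = q by rewrite acosK// in_itv.
have sq : sin (acos q) = `|b| / n.
  by rewrite sin_acos// qb sqrtr_sqr normrM [X in _ * X]ger0_norm// invr_ge0 ltW.
have h0 := acos_ge0 q1; have hpi := acos_lepi q1; have pp := pi_gt0 R.
case: ifP => b0.
  split; first by apply/andP; split => //; lra.
  by rewrite cq sq ger0_norm// /q; congr Complex; field.
have bn : b < 0 by rewrite ltNge b0.
split.
  rewrite ltrN2; apply/andP; split; last lra.
  apply: acos_ltpi; case/andP: q1 => q1 ->; rewrite andbT lt_neqAle q1 andbT.
  apply/eqP => e; have : (b / n) ^+ 2 = 0 by rewrite -qb -e; ring.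
  move=> /eqP; rewrite sqrf_eq0 mulf_eq0 invr_eq0 (negbTE n0) orbF => /eqP b00.
  by rewrite b00 ltxx in bn.
by rewrite cosN sinN cq sq ltr0_norm// /q; congr Complex; field.
Qed.

End Argument.

Section Subgraphs.
Variables (V E : finType) (v1 v2 : E -> V).

(* Multigraph on V in which the edge e joins v1 e and v2 e. Only meaningful
   without loops: mdeg would count a loop once. *)
Definition mdeg (M : {set E}) (v : V) : nat :=
  #|[set e in M | (v1 e == v) || (v2 e == v)]|.

Definition gdeg (v : V) : nat := mdeg [set: E] v.

Definition admissible (C : V -> {fset nat}) : {set {set E}} :=
  [set M | [forall v, mdeg M v \in C v]].

Variable R : realType.

Definition subgraph_poly (C : V -> {fset nat}) : {poly R[i]} :=
  \sum_(M in admissible C) 'X^#|M|.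

Definition vertex_poly (C : V -> {fset nat}) (v : V) : {poly R[i]} :=
  \sum_(k <- C v) 'C(gdeg v, k)%:R *: 'X^k.

Definition angle_set (phi : V -> R) : set R :=
  [set theta | - pi <= theta <= pi /\
     exists th : V -> R, (forall v, `|th v| <= pi / 2 - phi v) /\
                         (forall e, th (v1 e) + th (v2 e) = theta)].

Lemma angle_set0 (phi : V -> R) :
  (forall v, 0 <= phi v <= pi / 2) -> angle_set phi 0.
Proof.
move=> phiP; have pp := pi_gt0 R; split; first by rewrite oppr_le0 !ltW.
exists (fun=> 0); split=> [v|e]; last by rewrite addr0.
by rewrite normr0 subr_ge0; case/andP: (phiP v).
Qed.

Lemma closed_angle_set (phi : V -> R) : closed (angle_set phi).
Proof.
pose T := prod_topology (fun _ : V => (R : topologicalType)).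
pose B (v : V) : set R := `[- (pi / 2 - phi v), pi / 2 - phi v]%classic.
pose K : set T := [set th : T | forall v, B v (th v)].
have cbox : compact K.
  apply: (@tychonoff V (fun=> (R : topologicalType)) B) => v.
  exact: segment_compact.
have [e0|/forallNP noE] := pselect (exists e : E, True); last first.
  have [[th thP]|no] := pselect (exists th : V -> R, K th).
    suff -> : angle_set phi = `[- pi, pi]%classic by exact: itv_closed.
    apply/seteqP; split => x /=; rewrite in_itv/=; first by case.
    move=> xpi; split=> //; exists th; split => [v|e]; last by case: (noE e).
    by have := thP v; rewrite /B /= in_itv/= ler_norml.
  suff -> : angle_set phi = set0 by exact: closed0.
  apply/seteqP; split => x //= -[_ [th [thP _]]]; apply: no; exists th => v /=.
  by rewrite /B /= in_itv/= -ler_norml.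
case: e0 => e0 _.
pose f (e : E) (th : T) : R := th (v1 e) + th (v2 e).
have cp (v : V) : continuous (fun th : T => th v : R).
  exact: (@proj_continuous V (fun=> (R : topologicalType)) v).
have cf e : continuous (f e).
  move=> th; exact: (@continuousD R R T _ _ th (cp (v1 e) th) (cp (v2 e) th)).
have cS : compact
    (K `&` \bigcap_(e in [set: E]) [set th : T | f e th - f e0 th = 0]).
  apply: compact_closedI => //; apply: closed_bigI => e _.
  apply: (@preimage_closed T R (fun th : T => f e th - f e0 th) [set 0]).
    by move=> th _; exact: (@continuousB R R T _ _ th (cf e th) (cf e0 th)).
  by apply: compact_closed; [exact: Rhausdorff|exact: compact_set1].
have -> : angle_set phi = `[- pi, pi]%classic `&`
    (f e0 @` (K `&` \bigcap_(e in [set: E]) [set th : T | f e th - f e0 th = 0])).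
  apply/seteqP; split => x /=; rewrite in_itv/=.
    move=> [xpi [th [thP sth]]]; split => //; exists th; last exact: sth.
    split => [v|e _ /=]; first by rewrite /B /= in_itv/= -ler_norml.
    by rewrite /f !sth subrr.
  move=> [xpi [th [thK thE] xE]]; rewrite -xE in xpi *.
  split=> //; exists th; split => [v|e].
    by have := thK v; rewrite /B /= in_itv/= ler_norml.
  by apply/eqP; rewrite -subr_eq0; apply/eqP; exact: (thE e I).
apply: closedI; first exact: itv_closed.
apply: compact_closed; first exact: Rhausdorff.
apply: continuous_compact => //.
by apply: continuous_subspaceT => th; exact: cf.
Qed.

(* Hence sup (angle_set phi) is the maximum of angle_set phi. *)
Lemma angle_set_max (phi : V -> R) : (forall v, 0 <= phi v <= pi / 2) ->
  angle_set phi (sup (angle_set phi)) /\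
  ubound (angle_set phi) (sup (angle_set phi)).
Proof.
move=> phiP; have S0 := angle_set0 phiP.
have hub : has_ubound (angle_set phi) by exists pi => x [/andP[]].
split; last exact: sup_upper_bound (conj (ex_intro _ 0 S0) hub).
have := closure_sup (ex_intro _ 0 S0) hub.
by have /closure_id <- := @closed_angle_set phi.
Qed.

End Subgraphs.

(* Main.v *)
Require Import Defs.
From HB Require Import structures.
From mathcomp Require Import all_boot all_order all_algebra.
From mathcomp Require Import ring lra.

(* Split every edge into two half-edges, each with its own variable.  By
   Grace-Walsh-Szego, the product over the vertices of the polarizations of the
   [p_v] does not vanish when each half-edge variable at [v] lies in the open
   half-plane bisected by [exp(i th_v)].  Asano contraction glues the two
   half-edges of every edge back together, and yields [P] without zeros on the
   ray of argument [th_(v1 e) + th_(v2 e)].  The contraction is only nondegenerate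
   once all half-edge variables are shifted by some [t > 0].  The shift is
   compatible with all the angles [s * th_v], [|s| < 1], at once, so the shifted
   polynomials have no zeros in the open sector [|arg| < max S], and neither has
   their nonzero limit [P], by Hurwitz. *)

Set Implicit Arguments.
Unset Strict Implicit.
Unset Printing Implicit Defensive.

Import Order.TTheory GRing.Theory Num.Theory.

Local Open Scope ring_scope.

(** * Zero-free half-planes, Asano contraction and displacement of roots *)

Section HalfPlanes.
Variable C : numClosedFieldType.
Implicit Types (a : nat -> C) (w x y z : C).

(** With this binomial normalization, [a k] is the coefficient of every [k]-subset of the [n]
    variables in the polarization. *)
Definition binom_poly (n : nat) (a : nat -> C) : {poly C} :=
  \poly_(k < n.+1) ('C(n, k)%:R * a k).

(** For [w = cis (- th)] this is the open half-plane bisected by exp(i th). *)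
Definition halfplane_stable (w : C) (p : {poly C}) : Prop :=
  forall z, 0 < 'Re (w * z) -> p.[z] != 0.

(** For [h != 0] the left side says that [2 * k / h] is within 1 of 1: inversion maps a half-plane
    to a disc. The two squared norms differ by [4 * k * ('Re h - k)]. *)
Lemma Re_ge_norm (k h : C) : 0 < k ->
  (`|2 * k - h| <= `|h|) = (k <= 'Re h).
Proof.
move=> k0; have kr : k \is Num.real by exact: gtr0_real.
have k2r : 2 * k \is Num.real by rewrite rpredM ?realn.
rewrite -ler_sqr ?nnegrE ?normr_ge0// !normC2_Re_Im !raddfB /=.
rewrite (Creal_ReP _ k2r) (Creal_ImP _ k2r) -subr_ge0.
have -> : 'Re h ^+ 2 + 'Im h ^+ 2 - ((2 * k - 'Re h) ^+ 2 + (0 - 'Im h) ^+ 2)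
    = (4 * k) * ('Re h - k) by ring.
by rewrite pmulr_rge0 ?subr_ge0// mulr_gt0.
Qed.

Lemma logderiv_prod_XsubC (r : seq C) z : (forall x, x \in r -> z != x) ->
  (\prod_(x <- r) ('X - x%:P))^`().[z] =
  (\prod_(x <- r) ('X - x%:P)).[z] * \sum_(x <- r) (z - x)^-1.
Proof.
elim: r => [|x r IH] zr; first by rewrite !big_nil mulr0 -polyC1 derivC horner0.
have zx : z - x != 0 by rewrite subr_eq0 zr ?mem_head.
rewrite !big_cons derivM hornerD !hornerM derivXsubC hornerXsubC hornerC IH.
  by field.
by move=> y yr; apply: zr; rewrite inE yr orbT.
Qed.

(** The right side is the polar derivative with pole [x]. Coefficientwise this is (n+1) C(n,k) =
    (n+1-k) C(n+1,k) = (k+1) C(n+1,k+1). *)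
Lemma binom_poly_shift n a x :
  n.+1%:R *: binom_poly n (fun k => a k + x * a k.+1) =
  n.+1%:R *: binom_poly n.+1 a + (x%:P - 'X) * (binom_poly n.+1 a)^`().
Proof.
apply/polyP => k; rewrite mulrBl coefD coefB !coefZ coefCM coefXM !coef_deriv.
have E m b j : (binom_poly m b)`_j = 'C(m, j)%:R * b j.
  by rewrite coef_poly ltnS; case: leqP => // mj; rewrite bin_small// mul0r.
rewrite !E; have := mul_bin_diag n.+1 k; have := mul_bin_down n.+1 k.
rewrite /= => /(congr1 (fun i => i%:R : C)) dn /(congr1 (fun i => i%:R : C)) dg.
rewrite !natrM in dn dg.
have -> : (if k == 0 then 0 else
   (('C(n.+1, k.-1.+1)%:R * a k.-1.+1) *+ k.-1.+1)) =
   k%:R * ('C(n.+1, k)%:R * a k) :> C.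
  by case: k {dn dg} => [|k]; rewrite ?mulr_natl ?mulr0n.
have [kn|nk] := leqP k n.+1; last first.
  by rewrite !bin_small ?(ltnW nk) ?leqW//; ring.
rewrite natrB// in dn.
rewrite -[_ *+ k.+1]mulr_natl mulrDr mulrDr !mulrA {1}dn dg; ring.
Qed.

(* Laguerre's theorem: the reciprocals of the points of the half-plane
   [k <= 'Re h] fill a disc having 0 on its boundary, so the logarithmic
   derivative divided by any [n >= deg p] stays in that disc. *)
Lemma halfplane_stable_shift n a w x :
  halfplane_stable w (binom_poly n.+1 a) -> 0 < 'Re (w * x) ->
  halfplane_stable w (binom_poly n (fun k => a k + x * a k.+1)).
Proof.
move=> st wx z wz; set p := binom_poly n.+1 a in st.
have w0 : w != 0 by apply: contraTneq wx => ->; rewrite mul0r raddf0 ltxx.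
have pz := st z wz.
suff : n.+1%:R * p.[z] + (x - z) * p^`().[z] != 0.
  apply: contraNneq => q0; have := congr1 (fun q => q.[z]) (binom_poly_shift n a x).
  by rewrite !(hornerD, hornerM, hornerZ, hornerN, hornerC, hornerX) q0 mulr0 => <-.
have [r pE] := closed_field_poly_normal p.
have lc0 : lead_coef p != 0.
  by rewrite lead_coef_eq0; apply: contraNneq pz => ->; rewrite horner0.
have rz t : t \in r -> 'Re (w * t) <= 0.
  move=> tr; rewrite real_leNgt ?Creal_Re ?real0//; apply/negP => /st /negP; apply.
  rewrite pE hornerZ mulf_eq0 (negbTE lc0) /= horner_prod prodf_seq_eq0.
  by apply/hasP; exists t => //=; rewrite hornerXsubC subrr.
have szr : (size r <= n.+1)%N.
  have : (size p <= n.+2)%N by exact: size_poly.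
  by rewrite pE size_scale// size_prod_XsubC ltnS.
set k := 'Re (w * z) in wz.
have kh t : t \in r -> k <= 'Re (w * (z - t)).
  by move=> tr; rewrite mulrBr raddfB /= lerBrDr gerDl rz.
have h0 h : k <= 'Re h -> h != 0.
  by move=> kh'; apply: contraTneq (lt_le_trans wz kh') => ->; rewrite raddf0 ltxx.
have zr t : t \in r -> z != t.
  by move=> /kh/h0; apply: contraNneq => ->; rewrite subrr mulr0.
set s := \sum_(t <- r) (z - t)^-1.
have -> : p^`().[z] = p.[z] * s.
  by rewrite [in LHS]pE [in RHS]pE derivZ !hornerZ logderiv_prod_XsubC// mulrA.
rewrite [n.+1%:R * _]mulrC mulrCA -mulrDr mulf_neq0//.
(* Each root [t] contributes [2 * k / (w * (z - t))], at distance at most 1 from 1. Each of the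
   [n.+1 - size r] roots lost to a degree drop contributes 0, also at distance 1. *)
pose q := 2 * k * s / w.
have dq : `|q - n.+1%:R| <= n.+1%:R.
  have -> : q - n.+1%:R =
      \sum_(t <- r) (2 * k / (w * (z - t)) - 1) - (n.+1 - size r)%:R.
    rewrite natrB// sumrB big_const_seq count_predT iter_addr addr0.
    rewrite /q /s mulr_sumr mulr_suml opprB addrA subrK; congr (_ - _).
    by apply: eq_bigr => t _; rewrite invfM; ring.
  apply: le_trans (ler_normB _ _) _; rewrite normr_nat natrB// -lerBrDr opprB.
  rewrite addrC subrK; apply: le_trans (ler_norm_sum _ _ _) _.
  have -> : (size r)%:R = \sum_(t <- r) 1 :> C.
    by rewrite big_const_seq count_predT iter_addr_0.
  rewrite !big_seq; apply: ler_sum => t tr; have ht := h0 _ (kh _ tr).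
  have -> : 2 * k / (w * (z - t)) - 1 = (2 * k - w * (z - t)) / (w * (z - t)).
    by rewrite mulrBl divff.
  rewrite normrM normfV ler_pdivrMr ?normr_gt0//.
  by rewrite mul1r Re_ge_norm// kh.
apply/eqP => e.
have s0 : s != 0.
  by apply: contra_eq_neq e => ->; rewrite mulr0 addr0 pnatr_eq0.
pose g := w * (z - x).
have gs : g * s / w = n.+1%:R.
  by apply/eqP; rewrite -subr_eq0 -[X in _ == X]oppr0 -e /g; apply/eqP; field.
have g0 : g != 0.
  by apply: contra_eq_neq gs => ->; rewrite !mul0r eq_sym pnatr_eq0.
(* The disc bound on [q] now reads [k <= 'Re g], which forces ['Re (w * x) <= 0]. *)
move: dq; have -> : q - n.+1%:R = (2 * k - g) / g * n.+1%:R.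
  by rewrite -gs /q; field; rewrite w0 g0.
rewrite !normrM normr_nat normfV -[leRHS]mul1r ler_pM2r ?ltr0n//.
rewrite ler_pdivrMr ?normr_gt0// mul1r Re_ge_norm// /g mulrBr raddfB /=.
by rewrite lerBrDr gerDl => /le_lt_trans/(_ wx); rewrite ltxx.
Qed.

(* Asano contraction. If [A = - D r], then the symbol vanishes at
   [X = 0, Y = D r / c] when ['Re (c / D) > 0], and otherwise at a pair with
   [Y] large and [X] close to [- c / D]. *)
Lemma asano_positive (A B c D d r : C) : 0 < d -> 0 < r ->
  (forall X Y, - d < 'Re X -> 0 <= 'Re Y ->
     A + B * X + c * Y + D * X * Y != 0) ->
  A + D * r != 0.
Proof.
move=> d0 r0 st; have rr : r \is Num.real by exact: gtr0_real.
have A0 : A != 0.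
  by have := st 0 0; rewrite raddf0 oppr_lt0 !(mulr0, addr0) lexx; apply.
apply/eqP => AD; have D0 : D != 0.
  by apply: contra_eq_neq AD => ->; rewrite mul0r addr0.
have {AD}AE : A = - (D * r) by apply/eqP; rewrite -subr_eq0 opprK AD.
pose b := B / D; pose c' := c / D.
have {st}st X Y : - d < 'Re X -> 0 <= 'Re Y -> (b + Y) * X = r - c' * Y -> False.
  move=> HX HY e; have /eqP := st X Y HX HY; apply.
  rewrite AE -[RHS](mulr0 D) -(subrr (r - c' * Y)) -{1}e /b /c'; field.
  exact: D0.
have [c0|c0] := real_leP (Creal_Re c') (real0 C); last first.
  have cn0 : c' != 0 by apply: contraTneq c0 => ->; rewrite raddf0 ltxx.
  apply: (st 0 (r / c')); rewrite ?raddf0 ?oppr_lt0//.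
    rewrite ReMl// ReV mulr_ge0 ?(ltW r0)// divr_ge0 ?ltW//.
    by rewrite exprn_gt0// normr_gt0.
  by rewrite mulr0 mulrC divfK// subrr.
set m := `|r + b * c'|.
have m0 : 0 < m + 1 by rewrite ltr_wpDl// /m normr_ge0.
(* Chosen so that [|b + t|] is at least [(m + 1) / d], whence [|u| < d] below. The pair
   [X = u - c'], [Y = t] then solves the equation in [st]. *)
pose t := `|b| + (m + 1) / d.
have t0 : 0 <= t by rewrite addr_ge0 ?normr_ge0// divr_ge0 ?ltW.
have tb : (m + 1) / d <= `|b + t|.
  have := lerB_dist t (- b); rewrite normrN opprK (ger0_norm t0) [t + b]addrC.
  by rewrite {1}/t [X in X - _]addrC addrK.
have bt0 : b + t != 0 by rewrite -normr_gt0 (lt_le_trans _ tb)// divr_gt0.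
pose u := (r + b * c') / (b + t).
have ud : `|u| < d.
  rewrite normrM normfV ltr_pdivrMr ?normr_gt0// -ltr_pdivrMl// mulrC.
  by apply: lt_le_trans tb; rewrite ltr_pM2r ?invr_gt0// ltrDl.
have uRe : - d < 'Re u.
  have := leif_normC_Re_Creal u => -[/le_lt_trans/(_ ud)].
  by rewrite real_ltr_norml ?Creal_Re// => /andP[].
apply: (st (u - c') t).
- rewrite raddfB /=; apply: lt_le_trans uRe _.
  by rewrite lerDl oppr_ge0.
- by rewrite (Creal_ReP _ (ger0_real t0)).
- by rewrite /u; field.
Qed.

(** Substituting [x = e + X / w1] and [y = e + Y / w2] turns the half-planes into ones containing 0
    in their interior. This supplies the margin [d = e * 'Re w1] of [asano_positive], applied with
    [r = w1 * w2 * z]. *)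
Lemma asano_shift (w1 w2 K00 K10 K01 K11 e z : C) :
  0 < 'Re w1 -> 0 < 'Re w2 -> 0 < e -> 0 < w1 * w2 * z ->
  (forall x y, 0 < 'Re (w1 * x) -> 0 < 'Re (w2 * y) ->
     K00 + K10 * x + K01 * y + K11 * x * y != 0) ->
  K00 + e * (K10 + K01) + (e ^+ 2 + z) * K11 != 0.
Proof.
move=> w10 w20 e0 r0 st; have er : e \is Num.real by exact: gtr0_real.
have Rne w : 0 < 'Re w -> w != 0.
  by apply: contraTneq => ->; rewrite raddf0 ltxx.
have w1n := Rne _ w10; have w2n := Rne _ w20.
have := @asano_positive (K00 + e * (K10 + K01) + e ^+ 2 * K11)
  ((K10 + e * K11) / w1) ((K01 + e * K11) / w2) (K11 / (w1 * w2))
  (e * 'Re w1) (w1 * w2 * z) (mulr_gt0 e0 w10) r0.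
set P := (X in (X -> _) -> _) => asano.
have -> : K00 + e * (K10 + K01) + (e ^+ 2 + z) * K11 =
  K00 + e * (K10 + K01) + e ^+ 2 * K11 + K11 / (w1 * w2) * (w1 * w2 * z).
  by field; rewrite w1n w2n.
apply: asano => X Y HX HY.
have -> : K00 + e * (K10 + K01) + e ^+ 2 * K11 + (K10 + e * K11) / w1 * X +
    (K01 + e * K11) / w2 * Y + K11 / (w1 * w2) * X * Y =
  K00 + K10 * (e + X / w1) + K01 * (e + Y / w2)
    + K11 * (e + X / w1) * (e + Y / w2) by field; rewrite w1n w2n.
apply: st; rewrite mulrDr [_ * (_ / _)]mulrC divfK// raddfD /= ReMr//.
  by rewrite [_ * e]mulrC -ltrBlDl sub0r.
by rewrite ltr_pwDl// mulr_gt0.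
Qed.

(* The quantitative form of Hurwitz' theorem: each root moves from distance
   [>= d] of [x] to at most the factor [1 + `|y - x| / d] of it. *)
Lemma norm_horner_le (p : {poly C}) n (d x y : C) :
  0 < d -> (size p <= n.+1)%N -> (forall z, root p z -> d <= `|x - z|) ->
  `|p.[y]| <= `|p.[x]| * (1 + `|y - x| / d) ^+ n.
Proof.
move=> d0 szp far; have [->|p0] := eqVneq p 0.
  by rewrite !horner0 normr0 mul0r.
have [r pE] := closed_field_poly_normal p.
have lc0 : lead_coef p != 0 by rewrite lead_coef_eq0.
have {}far z : z \in r -> d <= `|x - z|.
  move=> zr; apply: far; rewrite pE rootE hornerZ mulf_eq0 (negbTE lc0) /=.
  rewrite horner_prod prodf_seq_eq0.
  by apply/hasP; exists z => //=; rewrite hornerXsubC subrr.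
have szr : (size r <= n)%N by move: szp; rewrite pE size_scale// size_prod_XsubC.
set K := 1 + _.
have K1 : 1 <= K by rewrite lerDl divr_ge0 ?normr_ge0// ltW.
have K0 : 0 <= K by apply: le_trans K1.
rewrite pE !hornerZ !normrM -mulrA ler_wpM2l ?normr_ge0//.
apply: (@le_trans _ _ (`|(\prod_(z <- r) ('X - z%:P)).[x]| * K ^+ size r)); last first.
  by rewrite ler_wpM2l ?normr_ge0// ler_weXn2l.
elim: r far {pE szr} => [|z r IH] far.
  by rewrite !big_nil !hornerC normr1 mul1r.
rewrite !big_cons !hornerM !hornerXsubC !normrM exprS mulrACA.
apply: ler_pM; rewrite ?normr_ge0//; last first.
  by apply: IH => t tr; apply: far; rewrite inE tr orbT.
have dz : d <= `|x - z| by apply: far; rewrite mem_head.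
rewrite -[y - z](subrK (x - z)); apply: le_trans (ler_normD _ _) _.
have -> : y - z - (x - z) = y - x by ring.
rewrite /K mulrDr mulr1 addrC lerD2l mulrA ler_pdivlMr// mulrC.
by rewrite ler_wpM2r ?normr_ge0.
Qed.

(** An explicit Lipschitz bound at 0, used for the limit of vanishing shift. *)
Lemma norm_horner_sub_le (p : {poly C}) : exists2 B : C, 0 <= B &
  forall e, 0 < e <= 1 -> `|p.[e] - p.[0]| <= e * B.
Proof.
elim/poly_ind: p => [|p c [B B0 IH]].
  by exists 0 => // e _; rewrite !horner0 subrr normr0 mulr0.
exists (B + `|p.[0]|); first by rewrite addr_ge0 ?normr_ge0.
move=> e /andP[e0 e1]; rewrite !hornerMXaddC mulr0 add0r addrK normrM.
rewrite (gtr0_norm e0) mulrC ler_pM2l// -[p.[e]](subrK p.[0]).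
apply: le_trans (ler_normD _ _) _; rewrite lerD2r.
apply: le_trans (IH e _) _; first by rewrite e0 e1.
by rewrite -[leRHS]mul1r ler_wpM2r.
Qed.

End HalfPlanes.

(** * Grace-Walsh-Szego for sums over sets of half-edges *)

Section SubsetSums.
Variables (C : numClosedFieldType) (H V : finType) (vt : H -> V).
Implicit Types (M D : {set H}) (v : V).

Definition fiber_card M v : nat := #|[set h in M | vt h == v]|.

Lemma fiber_card_setU1 h M v : h \notin M ->
  fiber_card (h |: M) v = ((vt h == v) + fiber_card M v)%N.
Proof.
move=> hM; have [e|e] := eqVneq (vt h) v.
  have -> : fiber_card (h |: M) v = #|h |: [set k in M | vt k == v]|.
    congr #|pred_of_set _|; apply/setP => k; rewrite !inE.
    by case: (eqVneq k h) => [->|]//=; rewrite e eqxx.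
  by rewrite cardsU1 inE (negbTE hM).
congr #|pred_of_set _|; apply/setP => k; rewrite !inE.
by case: (eqVneq k h) => [->|]//=; rewrite (negbTE e) andbF.
Qed.

Variables (w : V -> C) (x : H -> C).
Hypothesis w_neq0 : forall v, w v != 0.
Hypothesis x_halfplane : forall h, 0 < 'Re (w (vt h) * x h).

(* Grace-Walsh-Szego, at all vertices simultaneously: summing over the choice
   of one half-edge at [v] turns the coefficient sequence [a v] into its
   polar shift. *)
Lemma subset_sum_neq0 D (a : V -> nat -> C) :
  (forall v, halfplane_stable (w v) (binom_poly (fiber_card D v) (a v))) ->
  \sum_(M : {set H} | M \subset D)
    (\prod_v a v (fiber_card M v)) * (\prod_(h in M) x h) != 0.
Proof.
have [n] := ubnP #|D|; elim: n D a => // n IH D a Dn st.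
have [D0|[h hD]] := set_0Vmem D.
  rewrite (big_pred1 set0); last by move=> M; rewrite D0 subset0.
  rewrite big_set0 mulr1; apply/prodf_neq0 => v _.
  (* Only the constant coefficients remain; the conjugate of [w v] is a point of the half-plane at
     which to evaluate. *)
  have := st v (w v)^*; rewrite -normCK D0.
  have wp : 0 < `|w v| ^+ 2 by rewrite exprn_gt0 ?normr_gt0.
  have F0 : fiber_card set0 v = 0%N.
    by apply/eqP; rewrite cards_eq0; apply/eqP/setP => k; rewrite !inE.
  rewrite (Creal_ReP _ (gtr0_real wp)) F0 => /(_ wp).
  by rewrite horner_poly big_ord1 mulr1 mul1r.
pose D' := D :\ h; pose v := vt h.
(* At [v], the first term collects the sets avoiding [h], and the second those containing [h], whose
   count at [v] is one larger. *)
pose a' u := if u == v then (fun k => a u k + x h * a u k.+1) else a u.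
have DE : D = h |: D' by rewrite setD1K.
have hD' : h \notin D' by rewrite !inE eqxx.
suff -> : \sum_(M : {set H} | M \subset D)
    (\prod_v a v (fiber_card M v)) * (\prod_(h in M) x h) =
  \sum_(M : {set H} | M \subset D')
    (\prod_v a' v (fiber_card M v)) * (\prod_(h in M) x h).
  apply: IH => [|u]; first by move: Dn; rewrite (cardsD1 h) hD ltnS.
  have := st u; rewrite DE fiber_card_setU1// /a' [u == v]eq_sym /v.
  case: eqP => [<-|//]; rewrite add1n => /halfplane_stable_shift; exact.
rewrite (bigID (fun M => h \in M)) /=.
rewrite (reindex_onto (fun M => h |: M) (fun M => M :\ h)) /=; last first.
  by move=> M /andP[_ hM]; rewrite setD1K.
have P1 M : (h |: M \subset D) && (h \in h |: M) && ((h |: M) :\ h == M) =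
    (M \subset D').
  rewrite setU11 andbT subsetD1.
  apply/andP/andP => [[hMD /eqP e]|[MD hM]].
    split; first by apply: subset_trans hMD; exact: subsetU1.
    by rewrite -e !inE eqxx.
  by rewrite subUset sub1set hD MD setU1K.
rewrite (eq_bigl _ _ P1) [X in _ + X](eq_bigl (fun M => M \subset D')); last first.
  by move=> M; rewrite subsetD1.
rewrite -big_split /=; apply: eq_bigr => M; rewrite subsetD1 => /andP[_ hM].
rewrite big_setU1//= mulrA -mulrDl; congr (_ * _).
rewrite (bigD1 v)//= [X in _ + X](bigD1 v)//= [RHS](bigD1 v)//=.
rewrite /a' eqxx fiber_card_setU1// eqxx add1n.
have -> : \prod_(i | i != v) a i (fiber_card (h |: M) i) =
    \prod_(i | i != v) a i (fiber_card M i).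
  apply: eq_bigr => u uv; rewrite fiber_card_setU1//.
  by rewrite [_ == u]eq_sym (negbTE uv).
have -> : \prod_(i | i != v)
    (if i == v then fun k => a i k + x h * a i k.+1 else a i) (fiber_card M i) =
    \prod_(i | i != v) a i (fiber_card M i).
  by apply: eq_bigr => u /negbTE ->.
ring.
Qed.

End SubsetSums.

(** * Contraction of the two half-edges of every edge *)

Section Contraction.
Variable E : finType.

(* An edge [e] has the half-edges [(e, false)] and [(e, true)]. *)
Definition edge_sum (S : comNzRingType) (c : {set E * bool} -> S)
    (u : E -> bool -> bool -> S) : S :=
  \sum_(M : {set E * bool})
    c M * \prod_(e : E) u e ((e, false) \in M) ((e, true) \in M).

Definition split_weight (S : comNzRingType) (x : E * bool -> S) e i j : S :=
  x (e, false) ^+ nat_of_bool i * x (e, true) ^+ nat_of_bool j.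

(* The image of [(x + t)^i (y + t)^j] under the Asano contraction
   [1, x, y, x y |-> 1, 0, 0, z]. *)
Definition contracted_weight (S : comNzRingType) (t z : S) (i j : bool) : S :=
  if i then if j then t ^+ 2 + z else t else if j then t else 1.

Lemma eq_edge_sum (S : comNzRingType) c (u u' : E -> bool -> bool -> S) :
  u =1 u' -> edge_sum c u = edge_sum c u'.
Proof.
move=> uE; apply: eq_bigr => M _; congr (_ * _).
by apply: eq_bigr => e _; rewrite uE.
Qed.

(** The coefficients depend only on the weights of the other edges, so the weight of [e] alone can
    be exchanged while they stay fixed. *)
Lemma edge_sum_affine (S : comNzRingType) c (u : E -> bool -> bool -> S) e :
  exists K00 K10 K01 K11 : S, forall u' : E -> bool -> bool -> S,
    (forall f, f != e -> u' f = u f) ->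
    edge_sum c u' = K00 * u' e false false + K10 * u' e true false
                    + K01 * u' e false true + K11 * u' e true true.
Proof.
pose K i j := \sum_(M : {set E * bool})
  c M * (((e, false) \in M) == i)%:R * (((e, true) \in M) == j)%:R *
  \prod_(f | f != e) u f ((f, false) \in M) ((f, true) \in M).
exists (K false false), (K true false), (K false true), (K true true) => u' uE.
rewrite /edge_sum /K !mulr_suml -!big_split /=; apply: eq_bigr => M _.
rewrite (bigD1 e)//=.
have -> : \prod_(f | f != e) u' f ((f, false) \in M) ((f, true) \in M) =
  \prod_(f | f != e) u f ((f, false) \in M) ((f, true) \in M).
  by apply: eq_bigr => f /uE ->.
by case: (_ \in M); case: (_ \in M); rewrite /=; ring.
Qed.

(** The edges are contracted one at a time. Nonvanishing is kept for all admissible half-edge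
    variables, so the two at the next edge are free to vary in [asano_shift]. *)
Lemma edge_sum_contract (C : numClosedFieldType) (c : {set E * bool} -> C)
    (w : E * bool -> C) (t z : C) :
  (forall h, 0 < 'Re (w h)) -> 0 < t ->
  (forall e, 0 < w (e, false) * w (e, true) * z) ->
  (forall x, (forall h, 0 < 'Re (w h * x h)) ->
     edge_sum c (split_weight x) != 0) ->
  edge_sum c (fun=> contracted_weight t z) != 0.
Proof.
move=> w0 t0 wz st.
have step (s : seq E) : forall x, (forall h, 0 < 'Re (w h * x h)) ->
    edge_sum c (fun e => if e \in s then contracted_weight t z
                         else split_weight x e) != 0.
  elim: s => [|e s IH] x xP; first exact: st.
  have [es|es] := boolP (e \in s).
    have := IH x xP; congr (_ != 0); apply: eq_edge_sum => f.
    by rewrite inE; case: eqP => [->|//]; rewrite es.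
  pose U (T : seq E) y f := if f \in T then contracted_weight t z
                            else split_weight y f : bool -> bool -> C.
  have [K00 [K10 [K01 [K11 KE]]]] := edge_sum_affine c (U s x) e.
  rewrite (KE (U (e :: s) x)); last first.
    by move=> f fe; rewrite /U inE (negbTE fe).
  rewrite /U mem_head /contracted_weight.
  have := @asano_shift C (w (e, false)) (w (e, true)) K00 K10 K01 K11 t z
    (w0 _) (w0 _) t0 (wz e).
  set P := (X in (X -> _) -> _) => asano.
  have {asano}asano : P -> K00 * 1 + K10 * t + K01 * t + K11 * (t ^+ 2 + z) != 0.
    by move=> /asano; congr (_ != 0); ring.
  apply: asano => p q wp wq.
  pose y h := if h == (e, false) then p else if h == (e, true) then q else x h.
  have yP h : 0 < 'Re (w h * y h).
    by rewrite /y; case: eqP => [->//|_]; case: eqP => [->//|_].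
  have := IH y yP; rewrite -/(U s y) (KE (U s y)).
    rewrite /U (negbTE es) /split_weight /y !eqxx /= !expr0 !expr1 !mulr1 !mul1r.
    by rewrite xpair_eqE andbF mulrA.
  move=> f fe; rewrite /U /split_weight /y !xpair_eqE (negbTE fe) /=.
  by [].
(* Once all edges are contracted the variables have disappeared, and any admissible point will
   do. *)
have x0 h : 0 < 'Re (w h * (w h)^*).
  have wn : w h != 0 by apply: contraTneq (w0 h) => ->; rewrite raddf0 ltxx.
  have wp : 0 < `|w h| ^+ 2 by rewrite exprn_gt0 ?normr_gt0.
  by rewrite -normCK (Creal_ReP _ (gtr0_real wp)).
have := step (enum E) _ x0; congr (_ != 0).
by apply: eq_edge_sum => e; rewrite mem_enum.
Qed.

Lemma edge_sum_split (S : comNzRingType) c (x : E * bool -> S) :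
  edge_sum c (split_weight x) = \sum_(M : {set E * bool}) c M * \prod_(h in M) x h.
Proof.
apply: eq_bigr => M _; congr (_ * _).
transitivity (\prod_(h : E * bool) if (h.1, h.2) \in M then x (h.1, h.2) else 1);
  last by rewrite [RHS]big_mkcond; apply: eq_bigr => -[].
rewrite -(pair_bigA _ (fun e b => if (e, b) \in M then x (e, b) else 1)) /=.
apply: eq_bigr => e _; rewrite big_bool /split_weight mulrC.
by case: (_ \in M); case: (_ \in M).
Qed.

(** At shift 0 an edge with exactly one chosen half-edge has weight 0, so only the doubles of edge
    sets survive. *)
Lemma edge_sum_diag (S : comNzRingType) c (z : S) :
  edge_sum c (fun=> contracted_weight 0 z) =
  \sum_(A : {set E}) c [set h | h.1 \in A] * z ^+ #|A|.
Proof.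
pose dbl (A : {set E}) : {set E * bool} := [set h | h.1 \in A].
pose hlf (M : {set E * bool}) : {set E} := [set e | (e, true) \in M].
rewrite /edge_sum (bigID (fun M => dbl (hlf M) == M)) /=.
rewrite [X in _ + X]big1 ?addr0; last first.
  move=> M nd; suff [e] : exists e, ((e, false) \in M) != ((e, true) \in M).
    move=> eM; rewrite (bigD1 e)//=; move: eM; rewrite /contracted_weight.
    by case: (_ \in M); case: (_ \in M) => //= _; rewrite !(mul0r, mulr0).
  apply/existsP; apply: contraNT nd => /existsPn ne.
  apply/eqP/setP => -[e b]; rewrite !inE /=.
  by have := ne e; rewrite negbK => /eqP; case: b => // ->.
rewrite (reindex_onto dbl hlf) /=; last by move=> M /eqP.
apply: eq_big => [A|A _].
  have -> : hlf (dbl A) = A by apply/setP => e; rewrite !inE.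
  by rewrite !eqxx.
congr (_ * _); rewrite -prodr_const [RHS]big_mkcond /=; apply: eq_bigr => e _.
by rewrite !inE /= /contracted_weight expr0n add0r; case: (e \in A).
Qed.

Lemma rmorph_edge_sum (S T : comNzRingType) (f : {rmorphism S -> T}) c t z :
  f (edge_sum c (fun=> contracted_weight t z)) =
  edge_sum (f \o c) (fun=> contracted_weight (f t) (f z)).
Proof.
rewrite rmorph_sum; apply: eq_bigr => M _; rewrite rmorphM rmorph_prod.
congr (_ * _); apply: eq_bigr => e _; rewrite /contracted_weight.
by case: (_ \in M); case: (_ \in M); rewrite ?rmorphD ?rmorphXn ?rmorph1.
Qed.

(** Each edge is of degree at most 1 in [z]. The bound is uniform in [t], as the limit requires. *)
Lemma size_edge_sum (S : comNzRingType) (c : {set E * bool} -> S) (t : S) :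
  (size (edge_sum (polyC \o c) (fun=> contracted_weight t%:P 'X)) <= #|E|.+1)%N.
Proof.
apply: leq_trans (size_sum _ _ _) _; apply/bigmax_leqP => M _.
rewrite /= mul_polyC; apply: leq_trans (size_scale_leq _ _) _.
apply: leq_trans (size_poly_prod_leq _ _) _.
rewrite leq_subLR addnS ltnS; apply: (@leq_trans (\sum_(e : E) 2)); last first.
  by rewrite sum_nat_const muln2 -addnn leqnn.
apply: leq_sum => e _; rewrite /contracted_weight.
have tC : (size t%:P <= 2)%N by apply: leq_trans (size_polyC_leq1 _) _.
case: (_ \in M); case: (_ \in M) => //; last by rewrite size_poly1.
by rewrite -polyC_exp addrC size_XaddC.
Qed.

End Contraction.

(** * Removal of the shift *)

Section Limit.
Variables (C : numClosedFieldType) (E : finType) (c : {set E * bool} -> C).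

Let P (t z : C) := edge_sum c (fun=> contracted_weight t z).

(** With no roots of [P t] within [d] of [x], [norm_horner_le] bounds [P t y] by a multiple of
    [P t x] independent of [t]. As [t] tends to 0, a zero at [x] spreads to every [y]. *)
Lemma edge_sum_limit (x y d : C) : 0 < d ->
  (forall t z : C, 0 < t -> `|x - z| < d -> P t z != 0) ->
  P 0 x = 0 -> P 0 y = 0.
Proof.
move=> d0 st Px.
pose Pz t := edge_sum (polyC \o c) (fun=> contracted_weight t%:P 'X).
pose Pt z := edge_sum (polyC \o c) (fun=> contracted_weight 'X z%:P).
have cE u : horner_eval u \o (polyC \o c) =1 c.
  by move=> M; rewrite /= horner_evalE hornerC.
have edge_cE u t z : edge_sum (horner_eval u \o (polyC \o c))
    (fun=> contracted_weight t z) = P t z.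
  by apply: eq_bigr => M _; rewrite cE.
have PzE t z : (Pz t).[z] = P t z.
  rewrite -horner_evalE rmorph_edge_sum edge_cE.
  by rewrite /= /horner_eval hornerC hornerX.
have PtE t z : (Pt z).[t] = P t z.
  rewrite -horner_evalE rmorph_edge_sum edge_cE.
  by rewrite /= /horner_eval hornerC hornerX.
set K := (1 + `|y - x| / d) ^+ #|E|.
have K0 : 0 <= K.
  by rewrite exprn_ge0// addr_ge0// divr_ge0 ?normr_ge0// ltW.
have PK t : 0 < t -> `|P t y| <= `|P t x| * K.
  move=> t0; rewrite -!PzE; apply: norm_horner_le => //.
    exact: size_edge_sum.
  move=> z /rootP; rewrite PzE => Pz0; rewrite real_leNgt ?normr_real ?(gtr0_real d0)//.
  by apply/negP => /(st t z t0); rewrite Pz0 eqxx.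
have [B1 B10 hB1] := norm_horner_sub_le (Pt y).
have [B2 B20 hB2] := norm_horner_sub_le (Pt x).
pose B := B1 + B2 * K; have B0 : 0 <= B by rewrite addr_ge0// mulr_ge0.
have bnd t : 0 < t <= 1 -> `|P 0 y| <= t * B.
  move=> t01; have /andP[t0 _] := t01.
  rewrite -[P 0 y](subrK (P t y)); apply: le_trans (ler_normD _ _) _.
  rewrite /B mulrDr lerD//; first by rewrite distrC -!PtE hB1.
  apply: le_trans (PK _ t0) _; rewrite mulrA ler_wpM2r//.
  by have := hB2 t t01; rewrite !PtE Px subr0.
apply/eqP; apply/negPn/negP => Py; set m := `|P 0 y|.
have m0 : 0 < m by rewrite normr_gt0.
have s0 : 0 < m + B + 1 by rewrite ltr_wpDl// addr_ge0// ltW.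
(* This [t] is at most 1 and makes [t * B] smaller than [m]. *)
have := bnd (m / (m + B + 1)).
rewrite divr_gt0// ler_pdivrMr// mul1r -addrA lerDl addr_ge0// => /(_ isT).
rewrite -/m addrA mulrAC ler_pdivlMr// ler_pM2l//.
have /lt_le_trans/[apply] : B < m + B + 1.
  by rewrite -addrA addrCA ltrDl addr_gt0.
by rewrite ltxx.
Qed.

End Limit.

(** * Nonvanishing of the shifted, contracted graph sum *)

Section GraphSum.
Variables (C : numClosedFieldType) (V E : finType) (v1 v2 : E -> V).
Variable N : V -> pred nat.

Definition endpoint (h : E * bool) : V := if h.2 then v2 h.1 else v1 h.1.

Definition degree_indicator (M : {set E * bool}) : C :=
  \prod_v (N v (fiber_card endpoint M v))%:R.

Lemma edge_sum_neq0 (w : V -> C) (t z : C) :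
  (forall v, 0 < 'Re (w v)) -> 0 < t ->
  (forall e, 0 < w (v1 e) * w (v2 e) * z) ->
  (forall v, halfplane_stable (w v)
     (binom_poly (fiber_card endpoint [set: E * bool] v) (fun k => (N v k)%:R))) ->
  edge_sum degree_indicator (fun=> contracted_weight t z) != 0.
Proof.
move=> w0 t0 wz st.
apply: (@edge_sum_contract _ _ _ (w \o endpoint)) => //= x xP.
have wn v : w v != 0 by apply: contraTneq (w0 v) => ->; rewrite raddf0 ltxx.
rewrite edge_sum_split.
have := subset_sum_neq0 wn xP st; congr (_ != 0).
by apply: eq_bigl => M; rewrite subsetT.
Qed.

End GraphSum.

From mathcomp Require Import finmap complex.
From mathcomp Require Import all_classical all_reals all_analysis.
Import numFieldNormedType.Exports.

(** * Half-edge counts, vertex degrees and the two polynomials *)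

Section Degrees.
Variables (V E : finType) (v1 v2 : E -> V).
Hypothesis v1_neq_v2 : forall e, v1 e <> v2 e.

(** Without loops, an edge has at most one half-edge at [v], so forgetting the side is injective
    there. *)
Lemma fiber_card_mdeg (A : {set E}) v :
  fiber_card (endpoint v1 v2) [set h | h.1 \in A] v = mdeg v1 v2 A v.
Proof.
rewrite /fiber_card /mdeg.
have -> : [set e in A | (v1 e == v) || (v2 e == v)] =
    fst @: [set h in [set h : E * bool | h.1 \in A] | endpoint v1 v2 h == v].
  apply/setP => e; apply/idP/imsetP.
    rewrite inE => /andP[eA /orP[]/eqP ev].
      by exists (e, false) => //; rewrite !inE eA /endpoint /= ev eqxx.
    by exists (e, true) => //; rewrite !inE eA /endpoint /= ev eqxx.
  move=> [[f b]]; rewrite !inE /endpoint /= => /andP[fA /eqP bv] ->.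
  by rewrite fA; case: b bv => ->; rewrite eqxx ?orbT.
rewrite card_in_imset// => -[e b] [f b']; rewrite !inE /endpoint /=.
move=> /andP[_ /eqP ev] /andP[_ /eqP fv] ef; subst f; congr (_, _).
case: b b' ev fv => -[]// <- e'.
  by case: (v1_neq_v2 e').
by case: (v1_neq_v2 (esym e')).
Qed.

Lemma degree_indicator_dbl (F : numClosedFieldType) (C : V -> {fset nat})
    (A : {set E}) :
  degree_indicator F v1 v2 (fun v => mem (C v)) [set h | h.1 \in A] =
  (A \in admissible v1 v2 C)%:R.
Proof.
rewrite /degree_indicator inE.
have [/forallP all|/forallPn[v nv]] := boolP [forall v, mdeg v1 v2 A v \in C v].
  by rewrite big1// => v _; rewrite fiber_card_mdeg /= all.
by rewrite (bigD1 v)//= fiber_card_mdeg (negbTE nv) mul0r.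
Qed.

Lemma edge_sum_subgraph_poly (R : realType) (C : V -> {fset nat}) (z : R[i]) :
  edge_sum (degree_indicator R[i] v1 v2 (fun v => mem (C v)))
    (fun=> contracted_weight 0 z) = (subgraph_poly v1 v2 R C).[z].
Proof.
rewrite edge_sum_diag /subgraph_poly horner_sum [RHS]big_mkcond /=.
apply: eq_bigr => A _; rewrite degree_indicator_dbl hornerXn.
by case: ifP; rewrite ?mul1r ?mul0r.
Qed.

Lemma binom_poly_vertex_poly (R : realType) (C : V -> {fset nat}) v :
  binom_poly (fiber_card (endpoint v1 v2) finset.setT v)
    (fun k => (k \in C v)%:R) = vertex_poly v1 v2 R C v.
Proof.
have -> : fiber_card (endpoint v1 v2) finset.setT v = gdeg v1 v2 v.
  rewrite /gdeg -fiber_card_mdeg; congr (fiber_card _ _ _).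
  by apply/setP => h; rewrite !inE.
apply/polyP => k; rewrite coef_poly coef_sum.
have -> : \sum_(j <- C v) ('C(gdeg v1 v2 v, j)%:R *: 'X^j : {poly R[i]})`_k =
    'C(gdeg v1 v2 v, k)%:R * (k \in C v)%:R.
  have [kC|kC] := boolP (k \in C v).
    rewrite (bigD1_seq k) ?fset_uniq//= coefZ coefXn eqxx big1 ?addr0// => j jk.
    by rewrite coefZ coefXn eq_sym (negbTE jk) mulr0.
  rewrite mulr0 big_seq big1// => j jC; rewrite coefZ coefXn.
  by case: eqP => [kj|_]; rewrite ?mulr0//; rewrite kj jC in kC.
by rewrite ltnS; case: leqP => // dk; rewrite bin_small// mul0r.
Qed.

End Degrees.

(** * Sectors and half-planes in terms of the principal argument *)

Section Arguments.
Variable R : realType.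
Implicit Types (x y z : R[i]) (a b : R).

Definition cis a : R[i] := Complex (cos a) (sin a).

Lemma cisD a b : cis (a + b) = cis a * cis b.
Proof. by rewrite /cis cosD sinD; congr Complex; rewrite addrC. Qed.

Lemma cis0 : cis 0 = 1.
Proof. by rewrite /cis cos0 sin0. Qed.

Lemma polar z : z != 0 -> z = (Normc.normc z)%:C%C * cis (carg z).
Proof.
move=> /cargP[_ {1}->]; rewrite /cis.
by apply/eqP; rewrite eq_complex /= !mul0r subr0 addr0 !eqxx.
Qed.

Lemma normrcE z : `|z| = (Normc.normc z)%:C%C.
Proof. by []. Qed.

Lemma normc_gt0 z : z != 0 -> 0 < Normc.normc z.
Proof. by rewrite -ltcR -normrcE normr_gt0. Qed.

Lemma Re_polar z : z != 0 -> complex.Re z = Normc.normc z * cos `|carg z|.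
Proof. by move=> /cargP[_ {1}->] /=; rewrite cos_norm. Qed.

(** Since [cos] decreases on [0, pi], the sector is the set where [f], the real part minus the
    modulus times [cos b], is positive. This [f] is 2-Lipschitz and vanishes at 0. *)
Lemma carg_near x b : x != 0 -> 0 <= b <= pi -> `|carg x| < b ->
  exists2 d : R, 0 < d & forall z, `|x - z| < d%:C%C -> z != 0 /\ `|carg z| < b.
Proof.
move=> x0 /andP[b0 bpi] xb.
have inI z : z != 0 -> `|carg z| \in `[0, pi].
  by move=> /cargP[/andP[h1 h2] _]; rewrite in_itv /= normr_ge0 ler_norml h2 ltW.
have bI : b \in `[0, pi] by rewrite in_itv /= b0 bpi.
pose f z := complex.Re z - Normc.normc z * cos b.
have f0 z : z != 0 -> (0 < f z) = (`|carg z| < b).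
  move=> z0; rewrite /f Re_polar// -mulrBr pmulr_rgt0 ?normc_gt0// subr_gt0.
  by rewrite (ltr_cos (inI z z0) bI).
have fx : 0 < f x by rewrite f0.
exists (f x / 2) => [|z]; first by rewrite divr_gt0.
rewrite normrcE ltcR => zx.
have fz : 0 < f z.
  have Rez : complex.Re x - complex.Re z <= Normc.normc (x - z).
    have := normc_ge_Re (x - z); rewrite normrcE lecR.
    by case: (x) (z) => p q [p' q'] /=; apply: le_trans; exact: ler_norm.
  have n1 : Normc.normc x - Normc.normc z <= Normc.normc (x - z).
    by rewrite -lecR rmorphB /= -!normrcE lerB_dist.
  have n2 : Normc.normc z - Normc.normc x <= Normc.normc (x - z).
    by rewrite -lecR rmorphB /= -!normrcE distrC lerB_dist.
  have nn : `|Normc.normc x - Normc.normc z| <= Normc.normc (x - z).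
    by rewrite ler_norml; apply/andP; split; lra.
  have cb : `|(Normc.normc x - Normc.normc z) * cos b| <= Normc.normc (x - z).
    by rewrite normrM -[leRHS]mulr1 ler_pM ?normr_ge0// cos_max.
  move: cb; rewrite ler_norml mulrBl => /andP[cb _].
  by move: zx cb Rez; rewrite /f; lra.
have z0 : z != 0.
  apply: contraTneq fz => ->; rewrite /f Normc.normc0 mul0r subr0.
  by rewrite ltxx.
by split=> //; rewrite -f0.
Qed.

Lemma cos_le0 a : pi / 2 <= `|a| <= 3 * pi / 2 -> cos a <= 0.
Proof.
move=> /andP[h1 h2]; rewrite -cos_norm -[X in cos X](subrK pi) cosDpi oppr_le0.
by apply: cos_ge0_pihalf; apply/andP; split; lra.
Qed.

(** The angle [- th + carg z] has absolute value between (pi - f) - (pi/2 - f) = pi/2 and pi + pi/2,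
    where the cosine is nonpositive. *)
Lemma sector_halfplane_disjoint (f th : R) z : 0 <= f <= pi / 2 ->
  `|th| <= pi / 2 - f -> z != 0 -> pi - f <= `|carg z| <= pi ->
  'Re (cis (- th) * z) <= 0.
Proof.
move=> /andP[f0 f1] tf z0 /andP[h1 h2]; rewrite -complexRe (polar z0) mulrCA -cisD.
rewrite -[0]/(0%:C%C) lecR /= mul0r subr0 mulr_ge0_le0 ?(ltW (normc_gt0 z0))//.
apply: cos_le0; move: tf h1 h2; rewrite ler_norml => /andP[t1 t2].
by case: (ler0P (carg z)) => c0; case: (ler0P (- th + carg z)) => c1 h1 h2;
  apply/andP; split; lra.
Qed.

End Arguments.

(** * Exclusion of roots in the open sector of half-angle max S *)

Local Open Scope classical_set_scope.

Theorem theorem4p2 (R : realType) (V E : finType) (v1 v2 : E -> V)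
    (v1_neq_v2 : forall e : E, v1 e <> v2 e)
    (gdeg_gt0 : forall v : V, (0 < gdeg v1 v2 v)%N)
    (C : V -> {fset nat})
    (C_neq0 : forall v : V, C v <> fset0)
    (admissible_neq0 : admissible v1 v2 C <> finset.set0)
    (phi : V -> R)
    (phi_itv : forall v : V, 0 <= phi v <= pi / 2)
    (arg_roots : forall (v : V) (zeta : R[i]), zeta <> 0 ->
       root (vertex_poly v1 v2 R C v) zeta ->
       pi - phi v <= `|carg zeta| <= pi)
    (xi : R[i]) (xi_neq0 : xi <> 0)
    (root_xi : root (subgraph_poly v1 v2 R C) xi) :
  sup (angle_set v1 v2 phi) <= `|carg xi| <= pi.
Proof.
have pp := pi_gt0 R; have {xi_neq0}/eqP xi0 := xi_neq0.
apply/andP; split; last first.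
  have [/andP[h1 h2] _] := cargP xi0.
  by rewrite ler_norml h2 ltW.
have [[/andP[_ bpi] [th [thphi thE]]] _] := angle_set_max v1 v2 phi_itv.
set b := sup _ in bpi thE *; rewrite leNgt; apply/negP => xib.
have b0 : 0 < b by apply: le_lt_trans xib; exact: normr_ge0.
have bI : 0 <= b <= pi by rewrite ltW.
have [d d0 near_xi] := carg_near xi0 bI xib.
(* A root inside the sector would spread to the point 1, where the value is the number of admissible
   edge sets. *)
have : (subgraph_poly v1 v2 R C).[1] = 0.
  rewrite -edge_sum_subgraph_poly//; apply: (@edge_sum_limit _ _ _ xi 1 d%:C%C).
  - by rewrite -[0]/(0%:C%C) ltcR.
  (* Scaling by [s] makes the angles at the two ends of each edge add up to exactly [carg z]. *)
  - move=> t z t0 /near_xi[z0 zb]; pose s := carg z / b.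
    have s1 : `|s| < 1.
      by rewrite normrM normfV (gtr0_norm b0) ltr_pdivrMr// mul1r.
    have sth v : `|s * th v| <= pi / 2 - phi v.
      rewrite normrM; apply: le_trans (thphi v).
      by rewrite -[leRHS]mul1r ler_wpM2r ?normr_ge0// ltW.
    apply: (@edge_sum_neq0 _ _ _ _ _ _ (fun v => cis (- (s * th v)))) => //.
    + move=> v; rewrite -complexRe -[0]/(0%:C%C) ltcR /= cosN.
      apply: cos_gt0_pihalf; rewrite -ltr_norml normrM.
      have /andP[f0 _] := phi_itv v.
      (* The strict bound by pi/2 comes from [|s| < 1], except at [th v = 0], where it is the
         positivity of pi/2. *)
      have [->|t0'] := eqVneq (th v) 0; first by rewrite normr0 mulr0 divr_gt0.
      apply: (@lt_le_trans _ _ `|th v|).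
        by rewrite -[ltRHS]mul1r ltr_pM2r// normr_gt0.
      by apply: le_trans (thphi v) _; lra.
    + move=> e; rewrite -cisD -opprD -mulrDr thE divfK ?gt_eqF//.
      rewrite {2}(polar z0) mulrCA -cisD addrC subrr cis0 mulr1.
      by rewrite -[0]/(0%:C%C) ltcR normc_gt0.
    + move=> v y y0; rewrite binom_poly_vertex_poly//; apply/negP => /arg_roots.
      have yn : y != 0 by apply: contraTneq y0 => ->; rewrite mulr0 raddf0 ltxx.
      move=> /(_ (elimN eqP yn)) yarg.
      have := sector_halfplane_disjoint (phi_itv v) (sth v) yn yarg.
      by move=> /(lt_le_trans y0); rewrite ltxx.
  - by rewrite edge_sum_subgraph_poly//; apply/eqP.
rewrite /subgraph_poly horner_sum.
under eq_bigr do rewrite hornerXn expr1n.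
rewrite sumr_const => /eqP; rewrite pnatr_eq0 cards_eq0 => /eqP.
exact: admissible_neq0.
Qed.
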